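(* Let $(L,\le)$ be a dual algebraic coframe such that $\mathcal{K}(L,\le)$ has a choice function. The residual derivative $\mu$ is a $\vee$-homomorphism, that is, for any $x,z\in L$, $\mu(x\vee z)=\mu(x)\vee\mu(z)$.
   Context: A filtered set is a nonempty poset in which any two elements have a common lower bound. An element $x$ of a poset $(L,\le)$ is dually compact if for every filtered $F\subset L$ having an infimum with $\bigwedge F\le x$ there is $f\in F$ with $f\le x$; $\mathcal{K}(L,\le)$ is the set of dually compact elements. A dual algebraic lattice is a lattice in which every subset has an infimum and every $x$ equals $\bigwedge F_x$ for some filtered $F_x\subset\mathcal{K}(L,\le)$. A coframe is a lattice in which every subset has an infimum and $x\vee\bigwedge_{s\in S}s=\bigwedge_{s\in S}(x\vee s)$ for all $x\in L$, $S\subset L$. A dual algebraic coframe is both. A choice function of a set $S$ is a map $\theta:\mathcal{P}(S)\setminus\{\emptyset\}\to S$ with $\theta(P)\in P$ for all $P$. $\mathcal{M}(x)$ is the set of maximal elements of $\{z\in L: z<x\}$. The residual derivative of $x$ is $\mu(x):=\bigwedge_{m\in\mathcal{M}(x)}m$ if $\mathcal{M}(x)\neq\emptyset$, and $\mu(x):=x$ otherwise. *)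

(* Defs.v *)
From mathcomp Require Import all_boot all_order.
From mathcomp Require Import boolp classical_sets.
Set Implicit Arguments.
Unset Strict Implicit.
Unset Printing Implicit Defensive.

Local Open Scope classical_set_scope.
Local Open Scope order_scope.

Section PosetDefs.
Variables (d : Order.disp_t) (L : porderType d).
Implicit Types (F : set L) (x m : L).

Definition filtered F : Prop :=
  F !=set0 /\
  forall a b, F a -> F b -> exists c, [/\ F c, c <= a & c <= b].

(* [infimums F i] says that the infimum of F exists and is i. *)
Definition dually_compact x : Prop :=
  forall F i, filtered F -> infimums F i -> i <= x ->
    exists2 f, F f & f <= x.

Definition dual_compacts : set L := [set x | dually_compact x].

Definition has_all_infima : Prop := forall S : set L, infimums S !=set0.

Definition lower_covers x : set L :=
  [set m | m < x /\ forall z, z < x -> m <= z -> z = m].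

(* [infimum x A] is x when A is empty, and otherwise the infimum of A as soon
   as that infimum exists, which is the case under [has_all_infima]. *)
Definition residual_derivative x : L := infimum x (lower_covers x).

End PosetDefs.

Arguments dual_compacts {d} L.
Arguments has_all_infima {d} L.

Section LatticeDefs.
Variables (d : Order.disp_t) (L : latticeType d).

Definition dual_algebraic : Prop :=
  has_all_infima L /\
  forall x : L, exists F : set L,
    [/\ filtered F, F `<=` dual_compacts L & infimums F x].

Definition coframe : Prop :=
  has_all_infima L /\
  forall (x i : L) (S : set L),
    infimums S i -> infimums [set Order.join x s | s in S] (Order.join x i).

Definition dual_algebraic_coframe : Prop := dual_algebraic /\ coframe.

End LatticeDefs.

(* The domain is the type of nonempty subsets of S; the values lie in S because
   [theta P] belongs to P. *)
Definition is_choice_function (T : Type) (S : set T)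
    (theta : {P : set T | P `<=` S /\ P !=set0} -> T) : Prop :=
  forall P, sval P (theta P).

Definition has_choice_function (T : Type) (S : set T) : Prop :=
  exists theta, @is_choice_function T S theta.

Arguments dual_algebraic {d} L.
Arguments coframe {d} L.
Arguments dual_algebraic_coframe {d} L.

(* Main.v *)
Require Import Defs.
From HB Require Import structures.
From mathcomp Require Import all_boot all_order.
From mathcomp Require Import boolp classical_sets.

(** Call [m] weakly covered by [x] when the interval [[m, x]] contains nothing
    besides its end points, so that [m] is either [x] or a lower cover of [x].
    With this convention the two cases in the definition of the residual
    derivative merge: mu(x) is the infimum of all [m] weakly covered by [x]
    ([residual_derivative_infimum]).

    A coframe is a distributive lattice ([coframe_joinIl]), and there the map
    [y |-> y `|` z] sends weak coverings to weak coverings, and so does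
    [y |-> y `&` z] ([weakly_covered_join], [weakly_covered_meet]). Stability
    under meets makes mu monotone, which gives mu(x) `|` mu(z) <= mu(x `|` z).

    For the other inequality, the coframe law writes mu(x) `|` mu(z) as the
    infimum of the elements [m `|` n], where [m] is weakly covered by [x] and
    [n] by [z] ([coframe_le_join]). It remains to see that each [m `|` n] is
    above mu(x `|` z), and this is [weak_covers_le_join]: either [m `|` n] is
    above [x `&` z], and then it is the meet of the two elements [m `|` z] and
    [x `|` n] weakly covered by [x `|` z]; or adding [x `&` z] to [m] and to
    [n] gives back [x] and [z], and then [m `|` n] is itself weakly covered by
    [x `|` z]. *)

Set Implicit Arguments.
Unset Strict Implicit.
Unset Printing Implicit Defensive.
Import Order.TTheory.
Local Open Scope classical_set_scope.
Local Open Scope order_scope.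

Definition weakly_covered (d : Order.disp_t) (L : porderType d) (m x : L) :=
  m <= x /\ forall y, m <= y -> y <= x -> y = m \/ y = x.

Lemma weakly_covered_refl (d : Order.disp_t) (L : porderType d) (x : L) :
  weakly_covered x x.
Proof.
by split=> // y xy yx; left; apply: le_anti; rewrite yx xy.
Qed.

Lemma lower_covers_weakly_covered (d : Order.disp_t) (L : porderType d)
    (m x : L) : lower_covers x m -> weakly_covered m x.
Proof.
case=> mx max_m; split=> [|y my yx]; first exact: ltW.
have [->|ynx] := eqVneq y x; first by right.
by left; apply: max_m; rewrite // lt_neqAle ynx.
Qed.

Lemma weakly_covered_lower_covers (d : Order.disp_t) (L : porderType d)
    (m x : L) : weakly_covered m x -> m = x \/ lower_covers x m.
Proof.
case=> mx mxP; have [->|mnx] := eqVneq m x; first by left.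
right; split=> [|y yx my]; first by rewrite lt_neqAle mnx.
by case: (mxP y my (ltW yx)) => // yE; rewrite yE ltxx in yx.
Qed.

(** The default value [x], taken when [x] has no lower cover, is the infimum of
    the remaining weakly covered element; when there are lower covers, adding
    [x] to them leaves the infimum unchanged. *)
Lemma residual_derivative_infimum (d : Order.disp_t) (L : porderType d)
    (x : L) :
  has_all_infima L ->
  infimums [set m | weakly_covered m x] (residual_derivative x).
Proof.
move=> infL; rewrite /residual_derivative /infimum.
case: eqP => [Mx0|/eqP/set0P[m0 Mm0]].
  split=> [m /weakly_covered_lower_covers[->//|Mm]|t]; last first.
    by apply; exact: weakly_covered_refl.
  by rewrite Mx0 in Mm.
have [lbM glbM] := xgetPex x (infL (lower_covers x)).
split=> [m /weakly_covered_lower_covers[->|]|t tlb]; last 2 first.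
- exact: lbM.
- by apply: glbM => m Mm; apply/tlb/lower_covers_weakly_covered.
by apply: le_trans (lbM _ Mm0) _; case: Mm0 => /ltW.
Qed.

Section DistributiveLattice.
Variables (d : Order.disp_t) (L : distrLatticeType d).
Implicit Types m n t x y z : L.

(** For [y] between [m `|` z] and [x `|` z], the meet [y `&` x] lies between [m]
    and [x], and [y] is recovered from it by joining [z]. *)
Lemma weakly_covered_join m x z :
  weakly_covered m x -> weakly_covered (m `|` z) (x `|` z).
Proof.
case=> mx mxP; split=> [|y]; first by rewrite leU2.
rewrite leUx => /andP[my zy] yxz.
have <- : (y `&` x) `|` z = y.
  by rewrite joinIl (join_idPl zy) (meet_idPl yxz).
by case: (mxP (y `&` x)) => [||->|->]; rewrite ?lexI ?my ?leIr; auto.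
Qed.

(** The order dual of the stability under joins: [y] is [y `|` m] met with
    [z]. *)
Lemma weakly_covered_meet m x z :
  weakly_covered m x -> weakly_covered (m `&` z) (x `&` z).
Proof.
case=> mx mxP; split=> [|y]; first by rewrite leI2.
rewrite lexI => mzy /andP[yx yz].
have <- : (y `|` m) `&` z = y.
  by rewrite meetUl (meet_idPl yz) (join_idPl mzy).
by case: (mxP (y `|` m)) => [||->|->]; rewrite ?leUx ?yx ?leUr; auto.
Qed.

Lemma weakly_covered_join_cases m x y :
  weakly_covered m x -> y <= x -> y <= m \/ m `|` y = x.
Proof.
case=> mx mxP yx; case: (mxP (m `|` y)); rewrite ?leUx ?leUl ?mx //.
  by move=> <-; left; rewrite leUr.
by right.
Qed.

(** The heart of the matter: [m `|` n] need not be weakly covered by [x `|` z],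
    but it always is a meet of elements weakly covered by [x `|` z]. *)
Lemma weak_covers_le_join m n x z t :
  weakly_covered m x -> weakly_covered n z ->
  (forall y, weakly_covered y (x `|` z) -> t <= y) -> t <= m `|` n.
Proof.
move=> mx nz tlb.
have above_meet : x `&` z <= m `|` n -> t <= m `|` n.
  move=> xzmn; have tmz : t <= m `|` z by apply/tlb/weakly_covered_join.
  have txn : t <= n `|` x.
    by apply: tlb; rewrite [x `|` z]joinC; apply: weakly_covered_join.
  (* by distributivity this meet is the join of m, n and x `&` z *)
  apply: (@le_trans _ _ ((m `|` z) `&` (n `|` x))); first by rewrite lexI tmz.
  rewrite meetUl !meetUr [z `&` x]meetC !leUx xzmn !andbT.
  by rewrite leIxl ?leUl // leIxl ?leUl // leIxr ?leUr.
have [xzm|mE] := weakly_covered_join_cases mx (leIl x z).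
  by apply: above_meet; rewrite lexUl.
have [xzn|nE] := weakly_covered_join_cases nz (leIr z x).
  by apply: above_meet; rewrite lexUr.
apply: tlb; set w := x `&` z in mE nE *.
(* m `&` w is weakly covered by x `&` w = w; join m `|` n to both sides *)
have := weakly_covered_join (m `|` n) (weakly_covered_meet w mx).
have -> : (m `&` w) `|` (m `|` n) = m `|` n.
  by apply/join_idPr; rewrite leIxl // leUl.
have -> : x `&` w = w by apply/meet_idPr; exact: leIl.
suff -> : w `|` (m `|` n) = x `|` z by [].
by rewrite -mE -nE joinACA joinxx joinC.
Qed.

Lemma residual_derivative_homo x y :
  has_all_infima L -> x <= y ->
  residual_derivative x <= residual_derivative y.
Proof.
move=> infL xy.
have [lbx _] := residual_derivative_infimum x infL.
have [_ glby] := residual_derivative_infimum y infL.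
apply: glby => m /(weakly_covered_meet x).
by rewrite (meet_idPr xy) => /lbx mux; apply: le_trans mux (leIl _ _).
Qed.

End DistributiveLattice.

(** This is the coframe law for two-element subsets. *)
Lemma coframe_joinIl (d : Order.disp_t) (L : latticeType d) :
  coframe L -> left_distributive (@Order.join d L) (@Order.meet d L).
Proof.
case=> _ coL x y z.
have xyI : infimums [set x; y] (x `&` y).
  split=> [u [->|->]|t tlb]; rewrite ?leIl ?leIr //.
  by rewrite lexI !tlb //=; [right|left].
have [_ glbz] := coL z _ _ xyI.
rewrite ![_ `|` z]joinC; apply: le_anti; apply/andP; split.
  by rewrite lexI !leU2 ?leIl ?leIr.
by apply: glbz => _ [u [->|->] <-]; rewrite ?leIl ?leIr.
Qed.

Lemma joinIl_meetUl (d : Order.disp_t) (L : latticeType d) :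
  left_distributive (@Order.join d L) (@Order.meet d L) ->
  left_distributive (@Order.meet d L) (@Order.join d L).
Proof.
move=> joinIl x y z.
rewrite [RHS]joinIl [z `|` _]joinC meetUK [x `|` (_ `&` _)]joinC joinIl.
by rewrite [z `|` x]joinC -meetA joinIK [y `|` x]joinC.
Qed.

(** Two applications of the coframe law, one for each argument of the join. *)
Lemma coframe_le_join (d : Order.disp_t) (L : latticeType d) (A B : set L)
    (a b t : L) :
  coframe L -> infimums A a -> infimums B b ->
  (forall m n, A m -> B n -> t <= m `|` n) -> t <= a `|` b.
Proof.
move=> [_ coL] Aa Bb tlb.
have [_ glb_a] := coL a _ _ Bb; apply: glb_a => _ [n Bn <-].
have [_ glb_n] := coL n _ _ Aa; rewrite joinC; apply: glb_n => _ [m Am <-].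
by rewrite joinC; apply: tlb.
Qed.

Lemma coframe_residual_derivative_join (d : Order.disp_t)
    (L : distrLatticeType d) (x z : L) :
  coframe L ->
  residual_derivative (x `|` z) =
  residual_derivative x `|` residual_derivative z.
Proof.
move=> coL; have infL : has_all_infima L by case: coL.
apply: le_anti; apply/andP; split; last first.
  by rewrite leUx !residual_derivative_homo ?leUl ?leUr.
have [lbxz _] := residual_derivative_infimum (x `|` z) infL.
apply: (coframe_le_join coL (residual_derivative_infimum x infL)
                            (residual_derivative_infimum z infL)).
by move=> m n mx nz; apply: weak_covers_le_join mx nz lbxz.
Qed.

Theorem theorem4p33 (d : Order.disp_t) (L : latticeType d)
    (HL : dual_algebraic_coframe L)
    (HK : has_choice_function (dual_compacts L)) (x z : L) :
  residual_derivative (Order.join x z) =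
  Order.join (residual_derivative x) (residual_derivative z).
Proof.
have [_ coL] := HL; have joinIL := coframe_joinIl coL.
pose D : distrLatticeType d := HB.pack (Order.Lattice.sort L)
  (Order.Lattice_isDistributive.Build d L (joinIl_meetUl joinIL) joinIL).
exact: (@coframe_residual_derivative_join d D x z coL).
Qed.
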